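(* Let $\mathcal{D}$ be a set of quantum states with a symmetric neighbouring relation $\sim$, let $\epsilon,\tilde\epsilon\ge0$ and $0\le\delta<1$. If a quantum channel $\mathcal{A}$ is $(\epsilon,\delta)$-differentially private, then it is also $(\tilde\epsilon,\tilde\delta)$-differentially private whenever $\tilde\delta\ge\delta$ and $$e^{\tilde\epsilon}\ge\frac{1-\tilde\delta}{1-\delta}\,(1+e^\epsilon)-1.$$
   Context: Hilbert spaces are finite-dimensional; a quantum channel is a completely positive trace-preserving map. $\mathcal{A}$ is $(\epsilon,\delta)$-differentially private if for all operators $0\le M\le I$ and all $\rho,\sigma\in\mathcal{D}$ with $\rho\sim\sigma$, $\operatorname{Tr}(M\mathcal{A}(\rho))\le e^\epsilon\operatorname{Tr}(M\mathcal{A}(\sigma))+\delta$. *)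

(* Defs.v *)
From mathcomp Require Import all_boot all_order all_algebra.
From mathcomp Require Import sesquilinear spectral.
From mathcomp Require Import complex mxtens.
From mathcomp Require Import classical_sets reals sequences exp.

Set Implicit Arguments.
Unset Strict Implicit.
Unset Printing Implicit Defensive.

Import Order.TTheory GRing.Theory Num.Theory.

Local Open Scope ring_scope.
Local Open Scope sesquilinear_scope.
Local Open Scope complex_scope.

(* A finite-dimensional Hilbert space is C^n, with C = R[i], and the operators
   on it are the matrices 'M[R[i]]_n.  In R[i], x <= y means that y - x is a
   nonnegative real number; in particular 0 <= x entails that x is real. *)

Definition psd (R : realType) (n : nat) (M : 'M[R[i]]_n) : Prop :=
  M \is hermsymmx /\ forall v : 'cV[R[i]]_n, 0 <= (v ^t* *m M *m v) 0 0.

Definition loewner (R : realType) (n : nat) (M N : 'M[R[i]]_n) : Prop :=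
  psd (N - M).

Definition is_state (R : realType) (n : nat) (rho : 'M[R[i]]_n) : Prop :=
  psd rho /\ \tr rho = 1.

(* The (i, j) block, of size n x n, of a matrix indexed as C^k (x) C^n. *)
Definition tens_block (R : realType) (k n : nat) (X : 'M[R[i]]_(k * n))
    (i j : 'I_k) : 'M[R[i]]_n :=
  \matrix_(a, b) X (mxtens_index (i, a)) (mxtens_index (j, b)).

(* The map id_k (x) A, which applies A to each block; see ampliation_tens. *)
Definition ampliation (R : realType) (k n m : nat)
    (A : 'M[R[i]]_n -> 'M[R[i]]_m) (X : 'M[R[i]]_(k * n)) :
    'M[R[i]]_(k * m) :=
  \matrix_(p, q)
    A (tens_block X (mxtens_unindex p).1 (mxtens_unindex q).1)
      (mxtens_unindex p).2 (mxtens_unindex q).2.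

Lemma ampliation_tens (R : realType) (k n m : nat)
    (A : {linear 'M[R[i]]_n -> 'M[R[i]]_m})
    (X : 'M[R[i]]_k) (Y : 'M[R[i]]_n) :
  ampliation A (tensmx X Y) = tensmx X (A Y).
Proof.
apply/matrixP => p q; rewrite !mxE.
set i := (mxtens_unindex p).1; set j := (mxtens_unindex q).1.
suff -> : tens_block (tensmx X Y) i j = X i j *: Y by rewrite linearZ mxE.
by apply/matrixP => a b; rewrite mxE tensmxE mxE.
Qed.

Definition positive_map (R : realType) (n m : nat)
    (A : 'M[R[i]]_n -> 'M[R[i]]_m) : Prop :=
  forall X : 'M[R[i]]_n, psd X -> psd (A X).

Definition completely_positive (R : realType) (n m : nat)
    (A : 'M[R[i]]_n -> 'M[R[i]]_m) : Prop :=
  forall k : nat, positive_map (@ampliation R k n m A).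

Definition trace_preserving (R : realType) (n m : nat)
    (A : 'M[R[i]]_n -> 'M[R[i]]_m) : Prop :=
  forall X : 'M[R[i]]_n, \tr (A X) = \tr X.

Definition quantum_channel (R : realType) (n m : nat)
    (A : {linear 'M[R[i]]_n -> 'M[R[i]]_m}) : Prop :=
  completely_positive A /\ trace_preserving A.

(* Under the hypotheses of use (A a channel, rho and sigma states) both traces
   are real, so the comparison in R[i] is the comparison of real numbers. *)
Definition differentially_private (R : realType) (n m : nat)
    (D : set 'M[R[i]]_n) (nb : 'M[R[i]]_n -> 'M[R[i]]_n -> Prop)
    (eps delta : R) (A : 'M[R[i]]_n -> 'M[R[i]]_m) : Prop :=
  forall (M : 'M[R[i]]_m) (rho sigma : 'M[R[i]]_n),
    loewner 0 M -> loewner M 1%:M ->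
    D rho -> D sigma -> nb rho sigma ->
    \tr (M *m A rho) <= (expR eps)%:C * \tr (M *m A sigma) + delta%:C.

(* Main.v *)
Require Import Defs.
From mathcomp Require Import all_boot all_order all_algebra.
From mathcomp Require Import sesquilinear spectral mxtens.
From mathcomp Require Import complex.
From mathcomp Require Import classical_sets reals sequences exp.
From mathcomp Require Import lra.

(** Write p = Tr(M A(rho)) and q = Tr(M A(sigma)), both in [0, 1].  Privacy
    tested on M gives p <= e q + delta, with e = exp eps; tested on I - M with
    rho and sigma exchanged, it gives 1 - q <= e (1 - p) + delta.  These two
    lines in the (q, p) plane meet at
    ((1 - delta) / (1 + e), (e + delta) / (1 + e)), and the hypothesis on
    e' = exp eps' says that the line p = e' q + delta' passes above that vertex;
    since it also starts above the first line at q = 0 and is steeper than the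
    second one (e' >= 1 >= 1 / e), it dominates the whole region. *)

Import Order.TTheory GRing.Theory Num.Theory.

Local Open Scope ring_scope.
Local Open Scope complex_scope.
Local Open Scope sesquilinear_scope.

Lemma private_region_le (R : realFieldType) (e e' d d' p q : R) :
  1 <= e -> 1 <= e' -> d < 1 -> d <= d' ->
  (1 - d') / (1 - d) * (1 + e) - 1 <= e' ->
  0 <= q -> p <= 1 ->
  p <= e * q + d -> 1 - q <= e * (1 - p) + d ->
  p <= e' * q + d'.
Proof.
move=> e1 e'1 d1 dd' He' q0 p1 Hpq Hqp.
have [d'1|d'1] := lerP 1 d'.
  have e'q0 : 0 <= e' * q by apply: mulr_ge0; lra.
  lra.
set s := (1 - d') / (1 - d) in He'.
have Hs : s * (1 - d) = 1 - d' by rewrite /s divfK //; lra.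
have s1 : s <= 1 by rewrite /s ler_pdivrMr; lra.
(* The case split is at the abscissa of the vertex. To its left, [h1] and [h2] add up to
   [e * q + d <= e' * q + d']. *)
have [Hq|Hq] := lerP (q * (1 + e)) (1 - d).
  have h1 : 0 <= (e' - (s * (1 + e) - 1)) * q by apply: mulr_ge0; lra.
  have h2 : 0 <= (1 - s) * (1 - d - q * (1 + e)) by apply: mulr_ge0; lra.
  lra.
(* To the right of the vertex: with [Hse], this is [1 + e] times the height of the new line above
   the vertex. *)
have h1 : 0 <= (e' - (s * (1 + e) - 1)) * (1 - d) by apply: mulr_ge0; lra.
have h2 : 0 <= (e' - 1) * (q * (1 + e) - (1 - d)) by apply: mulr_ge0; lra.
have h3 : 0 <= (e - 1) * (q * (1 + e) - (1 - d)) by apply: mulr_ge0; lra.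
have Hse : s * (1 - d) * (1 + e) = (1 - d') * (1 + e) by rewrite Hs.
(* The left side is [1 + e] times the line of slope 1 through the vertex. It separates the new line,
   of slope [e' >= 1], from the second constraint, of slope [1 / e <= 1]; [h3] gives the latter
   comparison. *)
have h4 : (1 + e) * (1 + q) - 2 * (1 - d) <= (1 + e) * (e' * q + d') by lra.
have h5 : 0 <= (1 + e) * (e * (1 - p) + d - (1 - q)) by apply: mulr_ge0; lra.
have h6 : 0 <= e * ((1 + e) * (e' * q + d') - ((1 + e) * (1 + q) - 2 * (1 - d)))
  by apply: mulr_ge0; lra.
have h7 : 0 <= e * (1 + e) * (e' * q + d' - p) by lra.
by move: h7; rewrite pmulr_rge0 ?subr_ge0 // mulr_gt0 //; lra.
Qed.

Lemma mxtrace_mulmxBl (S : pzRingType) (n : nat) (M N X : 'M[S]_n) :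
  \tr ((M - N) *m X) = \tr (M *m X) - \tr (N *m X).
Proof. by rewrite mulmxBl raddfB. Qed.

(** Diagonalising [X] in an orthonormal eigenbasis [v i] turns the trace into the sum of the
    eigenvalues [d 0 i] weighted by the values of the quadratic form of [M] at [v i]. *)
Lemma psd_mxtrace_mul_ge0 (R : realType) (n : nat) (M X : 'M[R[i]]_n) :
  psd M -> psd X -> 0 <= \tr (M *m X).
Proof.
move=> [_ M0] [Xherm X0].
set P := spectralmx X; set d := spectral_diag X.
have Pu : P \is unitarymx by exact: spectral_unitarymx.
have XE : X = P ^t* *m diag_mx d *m P.
  by rewrite -invmx_unitary //; apply/orthomx_spectralP/hermitian_normalmx.
pose v i : 'cV[R[i]]_n := col i (P ^t*).
have quad (N : 'M[R[i]]_n) i :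
    (P *m N *m P ^t*) i i = ((v i) ^t* *m N *m v i) 0 0.
  rewrite [RHS]mxE [LHS]mxE; apply: eq_bigr => k _.
  congr (_ * _); last by rewrite [RHS]mxE.
  rewrite !mxE; apply: eq_bigr => l _; congr (_ * _).
  by rewrite !mxE conjCK.
(* The eigenvalue is the quadratic form of [X] at its unit eigenvector [v i]. *)
have d0 i : 0 <= d 0 i.
  have := X0 (v i); rewrite -quad XE !mulmxA (unitarymxP Pu) mul1mx.
  by rewrite -mulmxA (unitarymxP Pu) mulmx1 mxE eqxx mulr1n.
rewrite XE mulmxA mxtrace_mulC !mulmxA mul_mx_diag.
apply: sumr_ge0 => i _; rewrite mxE quad.
exact: mulr_ge0.
Qed.

Lemma psd_castmx (R : realType) (n n' : nat) (e : n = n') (X : 'M[R[i]]_n) :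
  psd (castmx (e, e) X) <-> psd X.
Proof. by case: _ / e; rewrite castmx_id. Qed.

(** A one-dimensional ancilla suffices: tensoring with the 1 by 1 identity only reindexes along
    [1 * n = n]. *)
Lemma completely_positive_psd (R : realType) (n m : nat)
    (A : {linear 'M[R[i]]_n -> 'M[R[i]]_m}) (X : 'M[R[i]]_n) :
  completely_positive A -> psd X -> psd (A X).
Proof.
move=> Acp Xpsd; have := Acp 1%N (1 *t X).
by rewrite ampliation_tens !tens_scalar1mx !psd_castmx; apply.
Qed.

Lemma loewner_mxtrace_mul_le (R : realType) (n : nat) (M N X : 'M[R[i]]_n) :
  loewner M N -> psd X -> \tr (M *m X) <= \tr (N *m X).
Proof.
by move=> MN X0; rewrite -subr_ge0 -mxtrace_mulmxBl psd_mxtrace_mul_ge0.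
Qed.

Lemma ge0_complexRe (R : realType) (z : R[i]) : 0 <= z -> z = (complex.Re z)%:C.
Proof. by case: z => a b; rewrite lecE /= => /andP[/eqP -> _]. Qed.

Theorem lemmaV9 (R : realType) (n m : nat)
    (D : set 'M[R[i]]_n) (nb : 'M[R[i]]_n -> 'M[R[i]]_n -> Prop)
    (D_states : forall rho, D rho -> is_state rho)
    (nb_sym : forall rho sigma, D rho -> D sigma ->
       nb rho sigma -> nb sigma rho)
    (eps eps' delta delta' : R)
    (eps_ge0 : 0 <= eps) (eps'_ge0 : 0 <= eps')
    (delta_ge0 : 0 <= delta) (delta_lt1 : delta < 1)
    (A : {linear 'M[R[i]]_n -> 'M[R[i]]_m})
    (A_channel : quantum_channel A)
    (A_dp : differentially_private D nb eps delta A)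
    (delta_le : delta <= delta')
    (eps'_ge : (1 - delta') / (1 - delta) * (1 + expR eps) - 1 <= expR eps') :
  differentially_private D nb eps' delta' A.
Proof.
move=> M rho sigma M0 M1 Drho Dsigma nbr.
have Apsd tau : D tau -> psd (A tau).
  by move=> /D_states[+ _]; apply: completely_positive_psd; case: A_channel.
have trA tau : D tau -> \tr (1%:M *m A tau) = 1.
  by move=> /D_states[_ tr1]; rewrite mul1mx (proj2 A_channel).
have tr_ge0 tau : D tau -> 0 <= \tr (M *m A tau).
  move=> Dtau; have := loewner_mxtrace_mul_le _ _ _ _ _ M0 (Apsd _ Dtau).
  by rewrite mul0mx mxtrace0.
have tr_le1 tau : D tau -> \tr (M *m A tau) <= 1.
  move=> Dtau; have := loewner_mxtrace_mul_le _ _ _ _ _ M1 (Apsd _ Dtau).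
  by rewrite trA.
have M0' : loewner 0 (1%:M - M) by rewrite /loewner subr0.
have M1' : loewner (1%:M - M) 1%:M.
  by rewrite /loewner opprB addrC subrK; move: M0; rewrite /loewner subr0.
(* Symmetry of [nb] allows the complementary effect to be tested on the exchanged pair. *)
have := A_dp _ _ _ M0' M1' Dsigma Drho (nb_sym _ _ Drho Dsigma nbr).
rewrite !mxtrace_mulmxBl (trA _ Drho) (trA _ Dsigma).
have := A_dp _ _ _ M0 M1 Drho Dsigma nbr.
have := tr_le1 _ Drho; have := tr_ge0 _ Dsigma.
(* Nonnegative traces are real, so all the inequalities descend from [R[i]] to [R]. *)
rewrite (ge0_complexRe _ _ (tr_ge0 _ Drho)).
rewrite (ge0_complexRe _ _ (tr_ge0 _ Dsigma)).
move: (complex.Re _) (complex.Re _) => p q.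
rewrite -(rmorph1 (real_complex R)) -(rmorph0 (real_complex R)).
rewrite -!rmorphB -!rmorphM -!rmorphD !lecR => q0 p1 Hpq Hqp.
apply: (@private_region_le _ (expR eps) _ delta) => //.
- by rewrite -expR0 ler_expR.
- by rewrite -expR0 ler_expR.
Qed.
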